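(* For each integer $n\geq 1$ let $\delta_n:\mathbb{R}\to\mathbb{R}$ be the continuous function with $\delta_n(x):=\frac{\sin(nx)}{\pi x}$ for $x\neq 0$ and $\delta_n(0):=\frac{n}{\pi}$. Then $(\delta_n)$ is a fundamental sequence, for which the sequence of second-order primitive functions $$\Delta_n(x):=\frac{1}{\pi}\int_0^x \mathrm{Si}(nt)\,dt=\frac{x}{\pi}\,\mathrm{Si}(nx)+\frac{\cos(nx)-1}{n\pi}$$ (so that $\Delta_n''=\delta_n$) tends uniformly on $\mathbb{R}$, as $n\to\infty$, to the function $\Delta(x):=\frac{|x|}{2}$.
   Context: $\mathrm{Si}(x):=\int_0^x\frac{\sin t}{t}\,dt$ is the sine integral (the integrand is taken to be $1$ at $t=0$). A sequence $(\varphi_n)$ of continuous functions $\varphi_n:\mathbb{R}\to\mathbb{C}$ is called a fundamental sequence if there exist an integer $k\geq 0$ and a sequence of functions $\Phi_n:\mathbb{R}\to\mathbb{C}$ such that $\Phi_n^{(k)}=\varphi_n$ on $\mathbb{R}$ for every $n$, and $(\Phi_n)$ converges uniformly on every bounded closed interval $[a,b]$ to some function $\Phi$. *)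

(* Defs.v *)
From Stdlib Require Import Reals.
From Coquelicot Require Import Coquelicot.

Open Scope R_scope.

(* [F^(k) = f] on the whole line, each of the k derivatives being required to
   exist everywhere.  Coquelicot's [is_derive_n] is not used: it is restricted
   to real-valued functions, and goes through the total operator [Derive],
   which has a default value where the function is not differentiable. *)
Fixpoint kth_derivative {V : NormedModule R_AbsRing} (k : nat) (F f : R -> V)
  : Prop :=
  match k with
  | O => forall x : R, F x = f x
  | S k' => exists G : R -> V,
      (forall x : R, is_derive F x (G x)) /\ kth_derivative k' G f
  end.

(* The norm is the absolute value on [R], the modulus on [C_R_NormedModule]. *)
Definition cv_uniform_on {V : NormedModule R_AbsRing} (D : R -> Prop)
    (F : nat -> R -> V) (L : R -> V) : Prop :=
  forall eps : R, 0 < eps ->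
  exists N : nat, forall n : nat, (N <= n)%nat ->
  forall x : R, D x -> norm (minus (F n x) (L x)) < eps.

(* Sequences are indexed by n >= 1; the value at n = 0 is irrelevant. *)
Definition fundamental_sequence (phi : nat -> R -> C) : Prop :=
  (forall n : nat, (1 <= n)%nat -> forall x : R, continuous (phi n) x) /\
  exists (k : nat) (Phi : nat -> R -> C),
    (forall n : nat, (1 <= n)%nat ->
       kth_derivative (V := C_R_NormedModule) k (Phi n) (phi n)) /\
    exists L : R -> C, forall a b : R,
      cv_uniform_on (V := C_R_NormedModule) (fun x => a <= x <= b) Phi L.

Definition sinc (t : R) : R :=
  if Req_EM_T t 0 then 1 else sin t / t.

(* [RInt] is total; the integrands here and in [Delta_seq] are continuous, so
   these are genuine Riemann integrals. *)
Definition Si (x : R) : R := RInt sinc 0 x.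

Definition delta_seq (n : nat) (x : R) : R :=
  if Req_EM_T x 0 then INR n / PI else sin (INR n * x) / (PI * x).

Definition Delta_seq (n : nat) (x : R) : R :=
  1 / PI * RInt (fun t => Si (INR n * t)) 0 x.

(* Main.v *)
Require Import Defs.
From Stdlib Require Import Reals Lra Lia.
From Coquelicot Require Import Coquelicot.

Open Scope R_scope.

(** Write [arc y] for the integral of [exp (- y sin t) * cos (y cos t)] over
    [0 <= t <= PI / 2]: it is the real part of the contour integral of
    [exp (i z) / (i z)] along the quarter circle of radius [y].  Differentiating
    under the integral sign, one meets an integrand that is itself a
    [t]-derivative, and gets [arc' = - sinc]; since [arc 0 = PI / 2], this gives
    [Si y = PI / 2 - arc y] for all [y] ([Si_arc]).  No limit is taken, so the
    value [PI / 2] of the Dirichlet integral comes together with a rate: on the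
    quarter circle [sin t >= t / 3], hence [0 <= y * |arc y| <= 3] for [y >= 0]
    ([arc_bound]).

    The closed form of [Delta_n] holds because both sides vanish at [0] and have
    the derivative [Si (n x) / PI]; differentiating once more yields [delta_n].
    For [x >= 0] the closed form then reads
    [Delta_n x - x / 2 = (cos (n x) - 1 - n x * arc (n x)) / (n PI)],
    whose absolute value is at most [5 / (n PI)], uniformly in [x]; negative [x]
    follow because [Si] is odd.  This uniform limit also makes [delta_n]
    a fundamental sequence, with [k = 2]. *)

(** * Functions determined by their derivative *)

Lemma eq_of_is_derive (f g df : R -> R) (a : R) :
  (forall x, is_derive f x (df x)) ->
  (forall x, is_derive g x (df x)) ->
  f a = g a -> forall x, f x = g x.
Proof.
  intros Hf Hg Ha x.
  assert (Hd : forall t, is_derive (fun u => f u - g u) t 0).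
  { intros t. replace 0 with (minus (df t) (df t))
      by (unfold minus, plus, opp; simpl; ring).
    now apply (is_derive_minus f g). }
  destruct (MVT_gen (fun u => f u - g u) a x (fun _ => 0)) as [c [_ Hc]].
  - intros; apply Hd.
  - intros t _. apply continuity_pt_filterlim.
    change (continuous (fun u => f u - g u) t).
    apply (ex_derive_continuous (V := R_NormedModule)). now exists 0.
  - lra.
Qed.

Lemma is_derive_RInt_continuous (f : R -> R) (a x : R) :
  (forall t, continuous f t) -> is_derive (fun y => RInt f a y) x (f x).
Proof.
  intros Hf. apply (is_derive_RInt f (fun y => RInt f a y) a x).
  - apply filter_forall; intros y.
    apply (RInt_correct (V := R_CompleteNormedModule)).
    apply (ex_RInt_continuous (V := R_CompleteNormedModule)).
    intros; apply Hf.
  - apply Hf.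
Qed.

(** * The sine integral *)

Lemma mult_sinc (x : R) : x * sinc x = sin x.
Proof.
  unfold sinc. destruct (Req_EM_T x 0) as [->|Hx].
  - rewrite sin_0; ring.
  - now field.
Qed.

Lemma continuous_sinc (x : R) : continuous sinc x.
Proof.
  destruct (Req_EM_T x 0) as [->|Hx].
  - apply continuity_pt_filterlim, continuity_pt_filterlim'.
    replace (sinc 0) with 1 by
      (unfold sinc; destruct (Req_EM_T 0 0); [reflexivity | lra]).
    apply (is_lim_ext_loc (fun x => sin x / x) sinc 0 1).
    + exists (mkposreal 1 Rlt_0_1). intros y _ Hy. unfold sinc.
      now destruct (Req_EM_T y 0).
    + apply is_lim_sinc_0.
  - apply (continuous_ext_loc sinc (fun x => sin x / x)).
    + exists (mkposreal _ (Rabs_pos_lt x Hx)). intros y Hy. unfold sinc.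
      destruct (Req_EM_T y 0) as [->|]; [exfalso | reflexivity].
      change (Rabs (0 - x) < Rabs x) in Hy.
      rewrite Rminus_0_l, Rabs_Ropp in Hy. lra.
    + apply (ex_derive_continuous (V := R_NormedModule)). auto_derive. easy.
Qed.

Lemma is_derive_Si (x : R) : is_derive Si x (sinc x).
Proof. apply is_derive_RInt_continuous, continuous_sinc. Qed.

Lemma Si_0 : Si 0 = 0.
Proof. apply (RInt_point (V := R_CompleteNormedModule)). Qed.

Lemma is_derive_Si_scal (a x : R) :
  is_derive (fun t => Si (a * t)) x (a * sinc (a * x)).
Proof.
  apply (is_derive_comp Si (fun t => a * t)).
  - apply is_derive_Si.
  - auto_derive; [easy | ring].
Qed.

Lemma sinc_opp (x : R) : sinc (- x) = sinc x.
Proof.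
  unfold sinc. destruct (Req_EM_T x 0), (Req_EM_T (- x) 0); try lra.
  rewrite sin_neg. now field.
Qed.

Lemma Si_opp (x : R) : Si (- x) = - Si x.
Proof.
  apply (eq_of_is_derive (fun t => Si (- t)) (fun t => - Si t)
           (fun t => - sinc t) 0).
  - intros t. rewrite <- sinc_opp.
    apply (is_derive_ext (fun t => Si (-1 * t))).
    { intros u. f_equal. ring. }
    replace (- sinc (- t)) with (-1 * sinc (-1 * t)).
    + apply is_derive_Si_scal.
    + replace (-1 * t) with (- t) by ring. ring.
  - intros t. apply (is_derive_opp Si), is_derive_Si.
  - rewrite Ropp_0, Si_0. ring.
Qed.

(** * The quarter-circle integral *)

Definition arc (y : R) : R :=
  RInt (fun t => exp (- (y * sin t)) * cos (y * cos t)) 0 (PI / 2).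

Lemma ex_RInt_arc (y : R) :
  ex_RInt (fun t => exp (- (y * sin t)) * cos (y * cos t)) 0 (PI / 2).
Proof.
  apply (ex_RInt_continuous (V := R_CompleteNormedModule)). intros t _.
  apply (ex_derive_continuous (V := R_NormedModule)). now auto_derive.
Qed.

Lemma arc_0 : arc 0 = PI / 2.
Proof.
  unfold arc. rewrite (RInt_ext _ (fun _ => 1)).
  - rewrite RInt_const. change ((PI / 2 - 0) * 1 = PI / 2). ring.
  - intros t _. rewrite !Rmult_0_l, Ropp_0, exp_0, cos_0. apply Rmult_1_r.
Qed.

Lemma is_derive_arc_integrand (t y : R) :
  is_derive (fun u => exp (- (u * sin t)) * cos (u * cos t)) y
    (- (exp (- (y * sin t)) * sin (t + y * cos t))).
Proof.
  auto_derive; [easy |]. rewrite sin_plus. ring.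
Qed.

(** Away from [y = 0] the integrand is the [t]-derivative of
    [exp (- y sin t) * sin (y cos t) / y]. *)
Lemma RInt_arc_derivative (y : R) :
  RInt (fun t => - (exp (- (y * sin t)) * sin (t + y * cos t))) 0 (PI / 2)
  = - sinc y.
Proof.
  apply is_RInt_unique.
  destruct (Req_EM_T y 0) as [->|Hy].
  - apply (is_RInt_ext (fun t => - sin t)).
    { intros t _. rewrite !Rmult_0_l, Ropp_0, exp_0, Rplus_0_r, Rmult_1_l.
      reflexivity. }
    replace (- sinc 0) with (minus (cos (PI / 2)) (cos 0)).
    + apply (is_RInt_derive cos (fun t => - sin t)).
      * intros t _. apply is_derive_cos.
      * intros t _. apply (ex_derive_continuous (V := R_NormedModule)).
        now auto_derive.
    + rewrite cos_PI2, cos_0. unfold sinc.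
      destruct (Req_EM_T 0 0); [| lra].
      unfold minus, plus, opp; simpl. ring.
  - set (G := fun t => exp (- (y * sin t)) * sin (y * cos t) / y).
    replace (- sinc y) with (minus (G (PI / 2)) (G 0)).
    + apply (is_RInt_derive G).
      * intros t _. unfold G. auto_derive; [easy |].
        rewrite sin_plus. now field.
      * intros t _. apply (ex_derive_continuous (V := R_NormedModule)).
        now auto_derive.
    + unfold G, sinc. destruct (Req_EM_T y 0); [easy |].
      rewrite cos_PI2, sin_PI2, cos_0, sin_0, !Rmult_0_r, sin_0, Ropp_0, exp_0.
      unfold minus, plus, opp; simpl. rewrite Rmult_1_r. now field.
Qed.

Lemma is_derive_arc (y : R) : is_derive arc y (- sinc y).
Proof.
  rewrite <- RInt_arc_derivative.
  rewrite (RInt_ext _ (fun t => Derive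
    (fun u => exp (- (u * sin t)) * cos (u * cos t)) y)).
  2: { intros t _. symmetry. apply is_derive_unique, is_derive_arc_integrand. }
  apply (is_derive_RInt_param
    (fun u t => exp (- (u * sin t)) * cos (u * cos t))).
  - apply filter_forall. intros u t _.
    eexists. apply is_derive_arc_integrand.
  - intros t _.
    apply (continuity_2d_pt_ext
      (fun u v => - (exp (- (u * sin v)) * sin (v + u * cos v)))).
    { intros u v. symmetry. apply is_derive_unique, is_derive_arc_integrand. }
    assert (Hsin : continuity_2d_pt (fun _ v => sin v) y t).
    { apply (continuity_1d_2d_pt_comp sin (fun _ v => v)).
      - apply continuity_sin.
      - apply continuity_2d_pt_id2. }
    assert (Hcos : continuity_2d_pt (fun _ v => cos v) y t).
    { apply (continuity_1d_2d_pt_comp cos (fun _ v => v)).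
      - apply continuity_cos.
      - apply continuity_2d_pt_id2. }
    apply continuity_2d_pt_opp, continuity_2d_pt_mult.
    + apply (continuity_1d_2d_pt_comp exp (fun u v => - (u * sin v))).
      * apply derivable_continuous_pt, derivable_pt_exp.
      * apply continuity_2d_pt_opp, continuity_2d_pt_mult; [| exact Hsin].
        apply continuity_2d_pt_id1.
    + apply (continuity_1d_2d_pt_comp sin (fun u v => v + u * cos v)).
      * apply continuity_sin.
      * apply continuity_2d_pt_plus; [apply continuity_2d_pt_id2 |].
        apply continuity_2d_pt_mult; [| exact Hcos].
        apply continuity_2d_pt_id1.
  - apply filter_forall. intros u. apply ex_RInt_arc.
Qed.

Lemma Si_arc (y : R) : Si y = PI / 2 - arc y.
Proof.
  apply (eq_of_is_derive Si (fun y => PI / 2 - arc y) sinc 0).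
  - apply is_derive_Si.
  - intros x. replace (sinc x) with (minus 0 (- sinc x)).
    + apply (is_derive_minus (fun _ => PI / 2) arc).
      * apply (is_derive_const (V := R_NormedModule)).
      * apply is_derive_arc.
    + unfold minus, plus, opp; simpl. ring.
  - rewrite Si_0, arc_0. ring.
Qed.

(** From [sin t >= t - t ^ 3 / 6] and [t <= PI / 2 <= 2]; any linear lower bound
    serves for the estimate of [arc]. *)
Lemma sin_ge_third (t : R) : 0 <= t <= PI / 2 -> t / 3 <= sin t.
Proof.
  intros Ht. pose proof PI_4 as HPI.
  destruct (pre_sin_bound t 0) as [H _]; [lra | lra |].
  unfold sin_approx, sin_term in H; simpl in H.
  assert (t * (t * t) <= t * 4) by (apply Rmult_le_compat_l; nra).
  lra.
Qed.

(** The integrand is dominated by [exp (- y t / 3)], whose integral over the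
    half line is [3 / y]. *)
Lemma arc_bound (y : R) : 0 <= y -> Rabs (y * arc y) <= 3.
Proof.
  intros Hy. pose proof PI_RGT_0 as HPI.
  destruct (Req_EM_T y 0) as [->|Hy0].
  { rewrite Rmult_0_l, Rabs_R0. lra. }
  set (G := fun t => - 3 / y * exp (- (y * (t / 3)))).
  assert (HG : is_RInt (fun t => exp (- (y * (t / 3)))) 0 (PI / 2)
                 (minus (G (PI / 2)) (G 0))).
  { apply (is_RInt_derive G).
    - intros t _. unfold G. auto_derive; [easy |]. unfold Rdiv; now field.
    - intros t _. apply (ex_derive_continuous (V := R_NormedModule)).
      now auto_derive. }
  assert (Habs : Rabs (arc y) <= minus (G (PI / 2)) (G 0)).
  { rewrite <- (is_RInt_unique _ _ _ _ HG).
    eapply Rle_trans.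
    { apply abs_RInt_le; [lra | apply ex_RInt_arc]. }
    apply RInt_le; [lra | | eexists; exact HG |].
    - apply ex_RInt_norm. apply ex_RInt_arc.
    - intros t Ht. rewrite Rabs_mult, (Rabs_pos_eq (exp _)).
      2: { left; apply exp_pos. }
      rewrite <- (Rmult_1_r (exp (- (y * (t / 3))))).
      apply Rmult_le_compat.
      + left; apply exp_pos.
      + apply Rabs_pos.
      + assert (Hs : t / 3 <= sin t) by (apply sin_ge_third; lra).
        apply (Rmult_le_compat_l y) in Hs; [| exact Hy].
        destruct (Rle_lt_or_eq_dec _ _ Hs) as [Hlt | ->]; [| lra].
        left. apply exp_increasing. lra.
      + apply Rabs_le, COS_bound. }
  rewrite Rabs_mult, (Rabs_pos_eq y Hy).
  apply (Rmult_le_compat_l y) in Habs; [| exact Hy].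
  eapply Rle_trans; [exact Habs |].
  unfold G, minus, plus, opp; simpl.
  replace (- (y * (0 / 3))) with 0 by field. rewrite exp_0.
  pose proof (exp_pos (- (y * (PI / 2 / 3)))).
  match goal with |- ?l <= _ =>
    replace l with (3 - 3 * exp (- (y * (PI / 2 / 3)))) by now field end.
  lra.
Qed.

(** * The second primitives of the Dirichlet kernels *)

Lemma is_derive_Delta_seq (n : nat) (x : R) :
  is_derive (Delta_seq n) x (1 / PI * Si (INR n * x)).
Proof.
  apply (is_derive_scal (fun x => RInt (fun t => Si (INR n * t)) 0 x)).
  apply (is_derive_RInt_continuous (fun t => Si (INR n * t))).
  intros t. apply (ex_derive_continuous (V := R_NormedModule)).
  eexists. apply is_derive_Si_scal.
Qed.

Lemma delta_seq_sinc (n : nat) (x : R) : (1 <= n)%nat ->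
  delta_seq n x = 1 / PI * (INR n * sinc (INR n * x)).
Proof.
  intros Hn. apply lt_0_INR in Hn. pose proof PI_RGT_0.
  unfold delta_seq, sinc.
  destruct (Req_EM_T x 0) as [->|Hx].
  - rewrite Rmult_0_r. destruct (Req_EM_T 0 0); [field; lra | lra].
  - destruct (Req_EM_T (INR n * x) 0) as [H0|_].
    + apply Rmult_integral in H0. lra.
    + field. repeat split; lra.
Qed.

Lemma is_derive_Delta_seq' (n : nat) (x : R) : (1 <= n)%nat ->
  is_derive (fun t => 1 / PI * Si (INR n * t)) x (delta_seq n x).
Proof.
  intros Hn. rewrite delta_seq_sinc by exact Hn.
  apply (is_derive_scal (fun t => Si (INR n * t))), is_derive_Si_scal.
Qed.

Lemma continuous_delta_seq (n : nat) (x : R) : (1 <= n)%nat ->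
  continuous (delta_seq n) x.
Proof.
  intros Hn.
  apply (continuous_ext (fun x => 1 / PI * (INR n * sinc (INR n * x)))).
  { intros t. now rewrite delta_seq_sinc. }
  apply (continuous_mult (fun _ => 1 / PI)); [apply continuous_const |].
  apply (continuous_mult (fun _ => INR n)); [apply continuous_const |].
  apply (continuous_comp (fun x => INR n * x) sinc).
  - apply (ex_derive_continuous (V := R_NormedModule)). now auto_derive.
  - apply continuous_sinc.
Qed.

Lemma Delta_seq_closed_form (n : nat) (x : R) : (1 <= n)%nat ->
  Delta_seq n x =
    x / PI * Si (INR n * x) + (cos (INR n * x) - 1) / (INR n * PI).
Proof.
  intros Hn. apply lt_0_INR in Hn. pose proof PI_RGT_0.
  apply (eq_of_is_derive (Delta_seq n)
    (fun x => x / PI * Si (INR n * x) + (cos (INR n * x) - 1) / (INR n * PI))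
    (fun x => 1 / PI * Si (INR n * x)) 0).
  - apply is_derive_Delta_seq.
  - intros t.
    replace (1 / PI * Si (INR n * t)) with
      (plus (plus (mult (1 / PI) (Si (INR n * t)))
                  (mult (t / PI) (INR n * sinc (INR n * t))))
            (- sin (INR n * t) / PI)).
    + apply (is_derive_plus (fun x => x / PI * Si (INR n * x))).
      * apply (is_derive_mult (fun x => x / PI) (fun x => Si (INR n * x))).
        -- auto_derive; [easy | field; lra].
        -- apply is_derive_Si_scal.
        -- exact Rmult_comm.
      * auto_derive; [easy | field; lra].
    + rewrite <- mult_sinc. unfold plus, mult; simpl. field. lra.
  - unfold Delta_seq. rewrite RInt_point. unfold zero; simpl.
    rewrite !Rmult_0_r, cos_0. field. lra.
Qed.

Lemma Delta_seq_opp (n : nat) (x : R) : (1 <= n)%nat ->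
  Delta_seq n (- x) = Delta_seq n x.
Proof.
  intros Hn. rewrite !Delta_seq_closed_form by exact Hn.
  replace (INR n * - x) with (- (INR n * x)) by ring.
  rewrite Si_opp, cos_neg. apply lt_0_INR in Hn. pose proof PI_RGT_0.
  field. lra.
Qed.

Lemma Delta_seq_bound_pos (n : nat) (x : R) : (1 <= n)%nat -> 0 <= x ->
  Rabs (Delta_seq n x - x / 2) <= 5 / INR n.
Proof.
  intros Hn Hx. rewrite Delta_seq_closed_form, Si_arc by exact Hn.
  apply lt_0_INR in Hn. pose proof PI2_1 as HPI.
  set (y := INR n * x).
  replace (x / PI * (PI / 2 - arc y) + (cos y - 1) / (INR n * PI) - x / 2)
    with ((cos y - 1 - y * arc y) / PI * / INR n)
    by (unfold y; field; lra).
  rewrite Rabs_mult, (Rabs_pos_eq (/ INR n)).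
  2: { left. now apply Rinv_0_lt_compat. }
  apply Rmult_le_compat_r.
  { left. now apply Rinv_0_lt_compat. }
  (* 2 bounds [|cos y - 1|] and 3 bounds [|y * arc y|]. *)
  assert (Hnum : Rabs (cos y - 1 - y * arc y) <= 5).
  { assert (Ha : Rabs (y * arc y) <= 3)
      by (apply arc_bound, Rmult_le_pos; lra).
    apply Rabs_le_between in Ha. pose proof (COS_bound y).
    apply Rabs_le. lra. }
  unfold Rdiv. rewrite Rabs_mult, (Rabs_pos_eq (/ PI)).
  2: { left. apply Rinv_0_lt_compat. lra. }
  assert (/ PI <= 1).
  { rewrite <- Rinv_1. apply Rinv_le_contravar; lra. }
  assert (0 < / PI) by (apply Rinv_0_lt_compat; lra).
  pose proof (Rabs_pos (cos y - 1 - y * arc y)). nra.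
Qed.

Lemma Delta_seq_bound (n : nat) (x : R) : (1 <= n)%nat ->
  Rabs (Delta_seq n x - Rabs x / 2) <= 5 / INR n.
Proof.
  intros Hn. unfold Rabs at 2. destruct (Rcase_abs x).
  - rewrite <- Delta_seq_opp by exact Hn.
    apply Delta_seq_bound_pos; [exact Hn | lra].
  - apply Delta_seq_bound_pos; [exact Hn | lra].
Qed.

Lemma cv_uniform_Delta_seq :
  cv_uniform_on (V := R_NormedModule) (fun _ : R => True)
    Delta_seq (fun x : R => Rabs x / 2).
Proof.
  intros eps Heps.
  destruct (archimed_cor1 (eps / 5)) as [N [HN HN0]]; [lra |].
  exists N. intros n Hn x _.
  apply Rle_lt_trans with (5 / INR n).
  - apply Delta_seq_bound. lia.
  - apply lt_0_INR in HN0.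
    apply le_INR in Hn.
    apply Rle_lt_trans with (5 * / INR N); [| lra].
    apply Rmult_le_compat_l; [lra |].
    now apply Rinv_le_contravar.
Qed.

(** * Real functions seen as complex-valued ones *)

Lemma is_linear_RtoC :
  is_linear (U := R_NormedModule) (V := C_R_NormedModule) RtoC.
Proof.
  apply (is_linear_prod (T := R_NormedModule) (U := R_NormedModule)
           (V := R_NormedModule) (fun x => x) (fun _ => 0)).
  - apply is_linear_id.
  - apply (is_linear_zero (U := R_NormedModule) (V := R_NormedModule)).
Qed.

Lemma is_derive_RtoC (f : R -> R) (x l : R) :
  is_derive f x l ->
  is_derive (V := C_R_NormedModule) (fun t => RtoC (f t)) x (RtoC l).
Proof.
  intros Hf.
  eapply filterdiff_ext_lin.
  - apply (filterdiff_comp (U := R_NormedModule) (V := R_NormedModule)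
             (W := C_R_NormedModule) f RtoC).
    + exact Hf.
    + apply filterdiff_linear, is_linear_RtoC.
  - intros y. apply (linear_scal _ is_linear_RtoC).
Qed.

Lemma kth_derivative_RtoC (k : nat) (F f : R -> R) :
  kth_derivative (V := R_NormedModule) k F f ->
  kth_derivative (V := C_R_NormedModule) k
    (fun x => RtoC (F x)) (fun x => RtoC (f x)).
Proof.
  revert F. induction k as [|k IH]; intros F.
  - intros H x. now rewrite (H x).
  - intros [G [HG Hk]]. exists (fun x => RtoC (G x)). split.
    + intros x. apply is_derive_RtoC, HG.
    + now apply IH.
Qed.

Lemma norm_RtoC (r : R) : norm (RtoC r : C_R_NormedModule) = Rabs r.
Proof.
  change (sqrt (Rabs r ^ 2 + Rabs 0 ^ 2) = Rabs r).
  rewrite Rabs_R0, pow_i by lia.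
  rewrite Rplus_0_r. apply sqrt_pow2, Rabs_pos.
Qed.

Lemma cv_uniform_on_RtoC (D : R -> Prop) (F : nat -> R -> R) (L : R -> R) :
  cv_uniform_on (V := R_NormedModule) D F L ->
  cv_uniform_on (V := C_R_NormedModule) D
    (fun n x => RtoC (F n x)) (fun x => RtoC (L x)).
Proof.
  intros H eps Heps. destruct (H eps Heps) as [N HN].
  exists N. intros n Hn x Hx.
  rewrite <- (linear_minus _ (F n x) (L x) is_linear_RtoC).
  rewrite norm_RtoC. now apply HN.
Qed.

Theorem lemma4 :
  fundamental_sequence (fun (n : nat) (x : R) => RtoC (delta_seq n x)) /\
  (forall n : nat, (1 <= n)%nat -> forall x : R,
     Delta_seq n x =
       x / PI * Si (INR n * x) + (cos (INR n * x) - 1) / (INR n * PI)) /\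
  (forall n : nat, (1 <= n)%nat ->
     kth_derivative (V := R_NormedModule) 2 (Delta_seq n) (delta_seq n)) /\
  cv_uniform_on (V := R_NormedModule) (fun _ : R => True)
    Delta_seq (fun x : R => Rabs x / 2).
Proof.
  assert (H2 : forall n : nat, (1 <= n)%nat ->
     kth_derivative (V := R_NormedModule) 2 (Delta_seq n) (delta_seq n)).
  { intros n Hn. exists (fun x => 1 / PI * Si (INR n * x)). split.
    - intros x. apply is_derive_Delta_seq.
    - exists (delta_seq n). split; [| intros x; reflexivity].
      intros x. now apply is_derive_Delta_seq'. }
  split; [| split; [| split]].
  - split.
    + intros n Hn x.
      apply (continuous_comp (W := C_R_NormedModule) (delta_seq n) RtoC).
      * now apply continuous_delta_seq.
      * apply (linear_cont (U := R_NormedModule) (V := C_R_NormedModule)).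
        apply is_linear_RtoC.
    + exists 2%nat, (fun n x => RtoC (Delta_seq n x)). split.
      * intros n Hn. now apply kth_derivative_RtoC, H2.
      * exists (fun x => RtoC (Rabs x / 2)). intros a b.
        apply cv_uniform_on_RtoC. intros eps Heps.
        destruct (cv_uniform_Delta_seq eps Heps) as [N HN].
        exists N. intros n Hn x _. now apply HN.
  - intros n Hn x. now apply Delta_seq_closed_form.
  - exact H2.
  - exact cv_uniform_Delta_seq.
Qed.
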